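(* Let $d\in\mathbb{N}$, let $\boldsymbol{Y}$ be the tail process of a stationary random field over $\mathbb{Z}^d$ such that $\mathbb{P}(\boldsymbol{Y}\in\mathcal{E}_0)=1$, let $\vartheta=\mathbb{E}[|\mathrm{e}(\boldsymbol{Y})|^{-1}]$, and let $\boldsymbol{Z}=(Z_{\boldsymbol{i}})_{\boldsymbol{i}\in\mathbb{Z}^d}$ be a random element of $\mathcal{E}$ such that $\mathbb{E}|\mathrm{e}(\boldsymbol{Z})|<\infty$. The following statements are equivalent. (i) $\boldsymbol{Z}$ is a representative of the anchored process (of $\boldsymbol{Y}$). (ii) For all measurable $h:\mathcal{E}_0\to[0,\infty)$, $$\mathbb{E}[h(\boldsymbol{Y})]=\frac{1}{\mathbb{E}|\mathrm{e}(\boldsymbol{Z})|}\,\mathbb{E}\left[\sum_{\boldsymbol{k}\in\mathrm{e}(\boldsymbol{Z})}h(\varphi_{\boldsymbol{k}}\boldsymbol{Z})\right].$$ (iii) For all measurable $h:\mathcal{E}\to[0,\infty)$ which are shift-invariant, $$\mathbb{E}[h(\boldsymbol{Z})]=\vartheta^{-1}\,\mathbb{E}\left[\frac{h(\boldsymbol{Y})}{|\mathrm{e}(\boldsymbol{Y})|}\right].$$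
   Context: $\mathbb{R}^{\mathbb{Z}^d}$ carries the product $\sigma$-algebra. For $\boldsymbol{k}\in\mathbb{Z}^d$ the shift is $\varphi_{\boldsymbol{k}}\boldsymbol{x}=(x_{\boldsymbol{i}+\boldsymbol{k}})_{\boldsymbol{i}\in\mathbb{Z}^d}$. The set of exceedance-points of $\boldsymbol{x}$ is $\mathrm{e}(\boldsymbol{x})=\{\boldsymbol{k}\in\mathbb{Z}^d:|x_{\boldsymbol{k}}|>1\}$, with cardinality $|\mathrm{e}(\boldsymbol{x})|$. Put $\mathcal{E}=\{\boldsymbol{x}\in\mathbb{R}^{\mathbb{Z}^d}:1\le|\mathrm{e}(\boldsymbol{x})|<\infty\}$ and $\mathcal{E}_0=\{\boldsymbol{x}\in\mathcal{E}:|x_{\boldsymbol{0}}|>1\}$. A function $h$ on $\mathcal{E}$ is shift-invariant if $h(\varphi_{\boldsymbol{k}}\boldsymbol{x})=h(\boldsymbol{x})$ for all $\boldsymbol{x}\in\mathcal{E}$, $\boldsymbol{k}\in\mathbb{Z}^d$. Tail process: a random field $\boldsymbol{Y}=(Y_{\boldsymbol{i}})_{\boldsymbol{i}\in\mathbb{Z}^d}$ is the tail process of a (strictly) stationary real-valued random field $\boldsymbol{X}=(X_{\boldsymbol{i}})_{\boldsymbol{i}\in\mathbb{Z}^d}$ if $\mathbb{P}(|Y_{\boldsymbol{0}}|>1)=1$ and, for every $m\in\mathbb{N}$, the conditional distribution of $(u^{-1}X_{\boldsymbol{i}})_{\boldsymbol{i}\in\{-m,\dots,m\}^d}$ given $|X_{\boldsymbol{0}}|>u$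 converges weakly, as $u\to\infty$, to the distribution of $(Y_{\boldsymbol{i}})_{\boldsymbol{i}\in\{-m,\dots,m\}^d}$. Anchoring function: a measurable map $A:\mathcal{E}_0\to\mathbb{Z}^d$ such that for all $\boldsymbol{x}\in\mathcal{E}_0$, $A(\boldsymbol{x})\in\mathrm{e}(\boldsymbol{x})$ and $A(\varphi_{\boldsymbol{k}}\boldsymbol{x})+\boldsymbol{k}=A(\boldsymbol{x})$ for all $\boldsymbol{k}\in\mathrm{e}(\boldsymbol{x})$. It is extended to $\mathcal{E}$ by $A(\boldsymbol{x}):=A(\varphi_{\boldsymbol{k}}\boldsymbol{x})+\boldsymbol{k}$ for any $\boldsymbol{k}\in\mathrm{e}(\boldsymbol{x})$ (independent of the choice of $\boldsymbol{k}$). Write $\varphi_A\boldsymbol{x}:=\varphi_{A(\boldsymbol{x})}\boldsymbol{x}$. The anchored process $\boldsymbol{Z}^A$ of $\boldsymbol{Y}$ is a random element of $\mathcal{E}_0$ with distribution $\mathbb{P}(\boldsymbol{Y}\in\cdot\mid A(\boldsymbol{Y})=\boldsymbol{0})$. A random element $\boldsymbol{Z}$ of $\mathcal{E}$ is a representative of the anchored process if $\varphi_A\boldsymbol{Z}$ has the same distribution as $\boldsymbol{Z}^A$ for some (equivalently, for every) anchoring function $A$. The quantity $\vartheta$ equals $\mathbb{P}(A(\boldsymbol{Y})=\boldsymbol{0})>0$ for every anchoring function $A$. *)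

(* Defs.v *)
From HB Require Import structures.
From mathcomp Require Import all_boot all_order all_algebra finmap.
From mathcomp Require Import all_classical all_reals all_analysis.

Set Implicit Arguments.
Unset Strict Implicit.
Unset Printing Implicit Defensive.

Import Order.TTheory GRing.Theory Num.Theory.
Import numFieldNormedType.Exports.

Local Open Scope classical_set_scope.
Local Open Scope ring_scope.

Notation lattice d := 'rV[int]_d.

Definition cylinders (R : realType) (d : nat) : set (set (lattice d -> R)) :=
  \bigcup_(i : lattice d)
    preimage_set_system setT (fun x : lattice d -> R => x i) measurable.

(* R^(Z^d), as a measurable type carrying the product sigma-algebra. *)
Notation field_space R d := (g_sigma_algebraType (@cylinders R d)).

Definition field_shift (R : realType) (d : nat) (k : lattice d)
  (x : field_space R d) : field_space R d := fun i => x (i + k).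

Definition exceed (R : realType) (d : nat) (x : field_space R d) :
  set (lattice d) := [set k | 1 < `|x k|].

(* The cardinality |e(x)| when e(x) is finite; it is only used for x in calE
   (fset_set of an infinite set is empty). *)
Definition nexceed (R : realType) (d : nat) (x : field_space R d) : nat :=
  #|` fset_set (exceed x)|.

Definition calE (R : realType) (d : nat) : set (field_space R d) :=
  [set x | finite_set (exceed x) /\ (1 <= nexceed x)%N].

Definition calE0 (R : realType) (d : nat) : set (field_space R d) :=
  [set x | calE x /\ 1 < `|x 0|].

Arguments calE : clear implicits.
Arguments calE0 : clear implicits.

Definition shift_invariant (R : realType) (d : nat) (T : Type)
    (h : field_space R d -> T) : Prop :=
  forall (x : field_space R d) (k : lattice d), calE R d x ->
    h (field_shift k x) = h x.

(* Law of X conditioned on the event {X in C}, which should have positive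
   probability. *)
Definition cond_law (dT dS : measure_display) (T : measurableType dT)
    (S : measurableType dS) (R : realType) (P : probability T R)
    (X : {RV P >-> S}) (C : set S) (B : set S) : \bar R :=
  (fine (P (X @^-1` (B `&` C))) / fine (P (X @^-1` C)))%:E.

Definition cond_expectation (dT : measure_display) (T : measurableType dT)
    (R : realType) (P : probability T R) (C : set T) (f : T -> R) : R :=
  (\int[P]_(w in C) f w) / fine (P C).

Definition stationary (R : realType) (d : nat) (dT : measure_display)
    (T : measurableType dT) (P : probability T R)
    (X : {RV P >-> field_space R d}) : Prop :=
  forall (k : lattice d) (B : set (field_space R d)), measurable B ->
    P ((field_shift k \o X) @^-1` B) = P (X @^-1` B).

Definition box (d m : nat) : Type :=
  {i : lattice d | forall j, `|i ord0 j| <= m%:Z}.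

Definition box_space (R : realType) (d m : nat) : topologicalType :=
  prod_topology (fun _ : box d m => R).

Definition restrict_box (R : realType) (d m : nat) (x : lattice d -> R) :
  box_space R d m := fun i => x (proj1_sig i).
Arguments restrict_box {R d} m x.

(* Positivity of P (|X_0| > u) is what makes the conditional laws meaningful;
   weak convergence is tested against bounded continuous functions. *)
Definition tail_process (R : realType) (d : nat) (dX dY : measure_display)
    (TX : measurableType dX) (TY : measurableType dY)
    (PX : probability TX R) (PY : probability TY R)
    (X : {RV PX >-> field_space R d}) (Y : {RV PY >-> field_space R d}) : Prop :=
  [/\ forall u : R, (0 < PX [set w | (u < `|X w 0|)%R])%E,
      PY [set w | (1 < `|Y w 0|)%R] = 1%E &
      forall (m : nat) (f : box_space R d m -> R),
        continuous f -> (exists M : R, forall y, `|f y| <= M) ->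
        cond_expectation PX [set w | u < `|X w 0|]
          (fun w => f (restrict_box m (fun i => u^-1 * X w i))) @[u --> +oo] -->
        \int[PY]_w f (restrict_box m (Y w))].

(* A is only meaningful on calE0; measurability is with respect to the discrete
   sigma-algebra on Z^d. *)
Definition anchoring (R : realType) (d : nat)
    (A : field_space R d -> lattice d) : Prop :=
  [/\ forall B : set (lattice d), measurable (calE0 R d `&` A @^-1` B),
      forall x, calE0 R d x -> exceed x (A x) &
      forall x k, calE0 R d x -> exceed x k -> A (field_shift k x) + k = A x].

(* The extension of A to calE, through an arbitrary choice of k in e(x);
   anchor_extE shows that the choice is irrelevant. *)
Definition anchor_ext (R : realType) (d : nat)
    (A : field_space R d -> lattice d) (x : field_space R d) : lattice d :=
  let k := xget 0 (exceed x) in A (field_shift k x) + k.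

Definition anchor_shift (R : realType) (d : nat)
    (A : field_space R d -> lattice d) (x : field_space R d) :
  field_space R d := field_shift (anchor_ext A x) x.

Definition anchored_law (R : realType) (d : nat) (dY : measure_display)
    (TY : measurableType dY) (PY : probability TY R)
    (Y : {RV PY >-> field_space R d}) (A : field_space R d -> lattice d) :
  set (field_space R d) -> \bar R :=
  cond_law Y (calE0 R d `&` [set x | A x = 0]).

Definition representative (R : realType) (d : nat) (dY dZ : measure_display)
    (TY : measurableType dY) (TZ : measurableType dZ)
    (PY : probability TY R) (PZ : probability TZ R)
    (Y : {RV PY >-> field_space R d}) (Z : {RV PZ >-> field_space R d}) : Prop :=
  exists A : field_space R d -> lattice d, anchoring A /\
    forall B : set (field_space R d), measurable B ->
      PZ ((anchor_shift A \o Z) @^-1` B) = anchored_law Y A B.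

Lemma shift_shift (R : realType) (d : nat) (k l : lattice d)
  (x : field_space R d) :
  field_shift k (field_shift l x) = field_shift (k + l) x.
Proof. by apply/funext => i; rewrite /field_shift addrA. Qed.

Lemma exceed_shift (R : realType) (d : nat) (k i : lattice d)
  (x : field_space R d) : exceed (field_shift k x) i = exceed x (i + k).
Proof. by []. Qed.

Lemma nexceed_gt0 (R : realType) (d : nat) (x : field_space R d) :
  finite_set (exceed x) -> (0 < nexceed x)%N <-> exceed x !=set0.
Proof.
move=> fx; rewrite /nexceed cardfs_gt0 -(rwP (fset0Pn _)); split => -[k].
  by rewrite in_fset_set// inE => xk; exists k.
by move=> xk; exists k; rewrite in_fset_set// inE.
Qed.

Lemma calE0_shift (R : realType) (d : nat) (k : lattice d)
  (x : field_space R d) : calE R d x -> exceed x k -> calE0 R d (field_shift k x).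
Proof.
move=> [fx _] xk.
have s0 : exceed (field_shift k x) 0 by rewrite exceed_shift add0r.
have fs : finite_set (exceed (field_shift k x)).
  have -> : exceed (field_shift k x) = (fun i => i - k) @` exceed x.
    apply/seteqP; split => [i xi|_ [j xj <-]].
      by exists (i + k); [exact: xi|rewrite addrK].
    by rewrite exceed_shift subrK.
  exact: finite_image.
by split => //; split => //; apply/(nexceed_gt0 fs); exists 0.
Qed.

Lemma anchor_extE (R : realType) (d : nat) (A : field_space R d -> lattice d)
    (x : field_space R d) (k : lattice d) :
  anchoring A -> calE R d x -> exceed x k -> anchor_ext A x = A (field_shift k x) + k.
Proof.
move=> [_ _ shA] Ex xk; rewrite /anchor_ext.
have xl : exceed x (xget 0 (exceed x)).
  by apply: (@xgetPex _ 0 (exceed x)); exists k.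
set l := xget _ _ in xl *.
have := shA _ (l - k) (calE0_shift Ex xk).
rewrite exceed_shift subrK shift_shift subrK => /(_ xl) <-.
by rewrite -addrA subrK.
Qed.

(* Main.v *)
Require Import Defs.
From HB Require Import structures.
From mathcomp Require Import all_boot all_order all_algebra finmap.
From mathcomp Require Import all_classical all_reals all_analysis measurable_realfun.

Set Implicit Arguments.
Unset Strict Implicit.
Unset Printing Implicit Defensive.

Import Order.TTheory GRing.Theory Num.Theory.
Import numFieldNormedType.Exports.

Local Open Scope classical_set_scope.
Local Open Scope ring_scope.
Local Open Scope ereal_scope.

(** The key fact is that the tail process Y is stationary as seen from its
    exceedance points: on the event that the origin and k are both exceedance
    points, moving the origin to k preserves the law of Y
    (tail_process_exceedance_stationary). For the stationary field X this is
    immediate, since the joint event |X_0| > u, |X_k| > u is moved by a shift to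
    |X_{-k}| > u, |X_0| > u, and for Y it follows by letting u tend to infinity.
    The indicators involved are not continuous, so the limit is taken for
    continuous functions that vanish off the events and increase to their
    indicators; a pi-lambda argument then reaches all measurable events.

    Let A be an anchoring function, C the set of fields of calE0 with anchor at
    the origin, and write N for the number of exceedance points and S h x for the
    sum of h (phi_k x) over the exceedance points k of x. Splitting calE0
    according to the position of the anchor and recentering every piece at its
    anchor, one gets the mass transport identity
      E [h Y] = E [S h Y; Y in C]                            (mass_transport).
    For shift-invariant h the average S (h / N) is h, so that
      E [h Y / N Y] = E [h Y; Y in C]             (tail_mass_transport_invariant),
    and h = 1 shows that theta = P (Y in C).

    The three implications are now short. If the anchored Z has the law of Y given
    Y in C, then E [S h Z] = E [S h Y | Y in C] = E [h Y] / P (Y in C), because S h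
    is shift-invariant; h = 1 identifies P (Y in C) with 1 / E [N Z]. Applying the
    resulting formula to h / N with h shift-invariant gives
    E [h Y / N Y] = E [h Z] / E [N Z], where h = 1 identifies theta with
    1 / E [N Z]. Finally, testing with the shift-invariant function
    1 (phi_A x in B), where A takes the lexicographically first exceedance point,
    gives P (phi_A Z in B) = P (Y in B, Y in C) / theta, which is the anchored
    law. *)

(** * The product sigma-algebra *)

Lemma measurable_coord (R : realType) (d : nat) (i : lattice d) :
  measurable_fun setT (fun x : field_space R d => x i).
Proof.
move=> _ B mB; apply: sub_sigma_algebra.
by exists i => //; exists B.
Qed.

Lemma measurable_field (R : realType) (d : nat) (dT : measure_display)
    (T : measurableType dT) (D : set T) (g : T -> field_space R d) :
  (forall i, measurable_fun D (fun t => g t i)) -> measurable_fun D g.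
Proof.
move=> mg mD.
have sub : preimage_set_system D g (@cylinders R d) `<=` measurable.
  move=> _ [_ [i _ [B mB <-]] <-] /=; rewrite setTI.
  exact: (mg i mD _ mB).
exact: (@measurability _ _ T (field_space R d) D g (@cylinders R d) erefl sub mD).
Qed.

Lemma measurable_shift (R : realType) (d : nat) (k : lattice d) :
  measurable_fun setT (@field_shift R d k).
Proof. by apply: measurable_field => i; exact: measurable_coord. Qed.

Lemma measurable_scale (R : realType) (d : nat) (c : R) :
  measurable_fun setT
    (fun x : field_space R d => (fun i => c * x i)%R : field_space R d).
Proof.
apply: measurable_field => i.
by apply: measurable_funM => //; exact: measurable_coord.
Qed.

(** * Test functions and the sets that they approximate *)

(** A function of a field can only be tested for continuity on a finite box, so a
    box configuration is extended to the lattice by zero. *)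
Definition box_ext (R : realType) (d m : nat) (y : box_space R d m) :
    lattice d -> R :=
  fun i => if pselect (forall j, (`|i ord0 j| <= m%:Z)%R) is left H
           then y (exist _ i H) else 0%R.

(** The functions to which the weak convergence in the definition of the tail
    process applies: bounded, continuous in the coordinates, and determined by
    the coordinates in some finite box. Measurability is recorded separately
    because continuity on boxes is the only continuity required. *)
Definition test_function (R : realType) (d : nat) (F : field_space R d -> R) :=
  [/\ (forall x, 0 <= F x <= 1)%R,
      measurable_fun setT F,
      (forall m, continuous (fun y : box_space R d m => F (box_ext y))) &
      exists m0, forall m x, (m0 <= m)%N -> F (box_ext (restrict_box m x)) = F x].

Lemma box_ext_restrict (R : realType) (d m : nat) (i : lattice d)
    (x : field_space R d) :
  (forall j, `|i ord0 j| <= m%:Z)%R -> box_ext (restrict_box m x) i = x i.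
Proof. by move=> H; rewrite /box_ext; case: pselect. Qed.

Lemma continuous_box_ext (R : realType) (d m : nat) (i : lattice d) :
  continuous (fun y : box_space R d m => box_ext y i : R).
Proof.
rewrite /box_ext; case: pselect => [H|_]; last exact: cst_continuous.
(* Continuity of projections is available for index types with decidable
   equality, which the type of points of a box obtains classically. *)
pose I : eqType := HB.pack (box d m) (gen_eqMixin (box d m)).
exact: (@proj_continuous I (fun=> (R : topologicalType)) (exist _ i H)).
Qed.

Lemma test_function_coord (R : realType) (d : nat) (i : lattice d) (u : R -> R) :
  continuous u -> (forall t, 0 <= u t <= 1)%R ->
  test_function (fun x : field_space R d => u (x i)).
Proof.
move=> cu u01; split => //.
- apply: (measurableT_comp _ (@measurable_coord R d i)).
  exact: continuous_measurable_fun.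
- move=> m y; apply: continuous_comp; last exact: cu.
  exact: continuous_box_ext.
- exists (\max_(j < d) `|i ord0 j|)%N => m x le_m.
  rewrite box_ext_restrict// => j.
  rewrite -lez_nat /= in le_m.
  rewrite -abszE lez_nat (leq_trans _ le_m)//.
  exact: (leq_bigmax (F := fun j : 'I_d => `|i ord0 j|%N)).
Qed.

Lemma test_function1 (R : realType) (d : nat) :
  test_function (fun _ : field_space R d => 1%R).
Proof.
split => //; first by move=> _; rewrite ler01 lexx.
- by move=> m; exact: cst_continuous.
- by exists 0%N.
Qed.

Lemma test_functionM (R : realType) (d : nat) (F G : field_space R d -> R) :
  test_function F -> test_function G -> test_function (F \* G)%R.
Proof.
move=> [F01 mF cF [m F_m]] [G01 mG cG [n G_n]]; split.
- move=> x /=; have /andP[F0 F1] := F01 x; have /andP[G0 G1] := G01 x.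
  by rewrite mulr_ge0//= mulr_ile1.
- exact: measurable_funM.
- move=> p y.
  exact: (@continuousM R _ (fun z => F (box_ext z)) (fun z => G (box_ext z)) y
            (cF p y) (cG p y)).
- exists (maxn m n) => p x; rewrite geq_max => /andP[mp np] /=.
  by rewrite F_m ?G_n.
Qed.

(** A continuous function that vanishes on the nonpositive reals and increases to
    the indicator of the positive reals as n grows. *)
Definition ramp (R : realType) (n : nat) (t : R) : R :=
  Num.min 1%R (Num.max 0%R (n%:R * t)%R).

Lemma ramp_continuous (R : realType) (n : nat) : continuous (@ramp R n).
Proof.
move=> t.
apply: (@continuous_min R R (cst 1%R) (fun s => Num.max 0%R (n%:R * s)%R)).
  exact: cst_continuous.
apply: (@continuous_max R R (cst 0%R) (fun s => (n%:R * s)%R)).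
  exact: cst_continuous.
exact: mulrl_continuous.
Qed.

Lemma ramp01 (R : realType) (n : nat) (t : R) : (0 <= ramp n t <= 1)%R.
Proof. by rewrite /ramp le_min ge_min le_max !lexx ler01. Qed.

Lemma ramp_le0 (R : realType) (n : nat) (t : R) : (t <= 0)%R -> ramp n t = 0%R.
Proof.
move=> t0; rewrite /ramp max_l; last by rewrite mulr_ge0_le0.
by rewrite min_r.
Qed.

Lemma ramp_cvg (R : realType) (t : R) :
  (fun n => ramp n t) @ \oo --> ((0 < t)%R%:R : R).
Proof.
have [t0|t0] := ltP 0%R t; last first.
  by under eq_fun do rewrite ramp_le0//; exact: cvg_cst.
apply: (@cvg_near_cst _ (R : topologicalType)).
near=> n; rewrite /ramp.
have nt : (1 <= n%:R * t)%R.
  rewrite -ler_pdivrMr// mul1r.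
  near: n; exact: nbhs_infty_ger.
by rewrite max_r ?(le_trans _ nt)// min_l.
Unshelve. all: by end_near. Qed.

(** Indicators of the form 1(x_i > a) or 1(|x_k| > 1) are not continuous, but they
    are limits of test functions that vanish off the set. The vanishing is what
    later makes the conditioning on an exceedance at the origin invisible. Test
    functions are also required after every shift, because one sequence has to
    serve for a set and for its shifted preimage. *)
Definition approximable (R : realType) (d : nat) (B : set (field_space R d)) :=
  exists F : nat -> field_space R d -> R,
  [/\ forall k n, test_function (F n \o field_shift k),
      forall n x, ~ B x -> F n x = 0%R &
      forall x, F ^~ x @ \oo --> (\1_B x : R)].

Lemma approximableT (R : realType) (d : nat) :
  approximable [set: field_space R d].
Proof.
exists (fun _ _ => 1%R); split => [*|n x nTx|x].
- exact: test_function1.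
- by exfalso; exact: nTx.
- by rewrite indicT; exact: cvg_cst.
Qed.

(** The products of the two approximating sequences approximate the intersection. *)
Lemma approximableI (R : realType) (d : nat) (A B : set (field_space R d)) :
  approximable A -> approximable B -> approximable (A `&` B).
Proof.
move=> [F [tF F0 cF]] [G [tG G0 cG]].
exists (fun n => (F n \* G n)%R); split => [k n|n x ABx|x].
- exact: (test_functionM (tF k n) (tG k n)).
- have [Ax|Ax] := pselect (A x); last by rewrite /= F0// mul0r.
  by rewrite /= G0 ?mulr0// => Bx; apply: ABx.
- by rewrite indicI; exact: cvgM (cF x) (cG x).
Qed.

Lemma approximable_gt (R : realType) (d : nat) (i : lattice d) (g : R -> R)
    (a : R) :
  continuous g -> approximable [set x : field_space R d | (a < g (x i))%R].
Proof.
move=> cg; exists (fun n x => ramp n (g (x i) - a)); split => [k n|n x|x].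
- apply: (@test_function_coord R d (i + k)%R (fun t => ramp n (g t - a))).
    move=> t; apply: (@continuous_comp R R R (fun s => g s - a)%R (ramp n)).
      by apply: (@continuousB R R R g (cst a)); [exact: cg|exact: cst_continuous].
    exact: ramp_continuous.
  by move=> t; exact: ramp01.
- by move=> /negP; rewrite -leNgt => gxa; rewrite ramp_le0// subr_le0.
- rewrite indicE (_ : (x \in _) = (0 < g (x i) - a)%R); first exact: ramp_cvg.
  by rewrite subr_gt0; apply/idP/idP; rewrite inE.
Qed.

(** * Exceedance-stationarity of the tail process *)

Lemma tail_process_cvg (R : realType) (d : nat) (dX dY : measure_display)
    (TX : measurableType dX) (TY : measurableType dY)
    (PX : probability TX R) (PY : probability TY R)
    (X : {RV PX >-> field_space R d}) (Y : {RV PY >-> field_space R d})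
    (F : field_space R d -> R) :
  tail_process X Y -> test_function F ->
  cond_expectation PX [set w | (u < `|X w 0|)%R]
    (fun w => F (fun i => u^-1 * X w i)%R) @[u --> +oo%R] -->
  (\int[PY]_w F (Y w))%R.
Proof.
move=> [_ _ XY] [F01 _ cF [m F_m]].
have F_bnd : exists M : R, forall y : box_space R d m, (`|F (box_ext y)| <= M)%R.
  by exists 1%R => y; have /andP[F0 F1] := F01 (box_ext y); rewrite ger0_norm.
have := XY m _ (cF m) F_bnd.
have FE (x : field_space R d) : F (box_ext (restrict_box m x)) = F x.
  exact: F_m.
under [in X in _ --> X -> _]eq_Rintegral do rewrite FE.
move=> H; apply: cvg_trans H; apply: near_eq_cvg; near=> u.
congr (_ / _)%R; apply: eq_Rintegral => w _; exact: FE.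
Unshelve. all: by end_near. Qed.

Lemma integral_shift_stationary (R : realType) (d : nat) (dX : measure_display)
    (TX : measurableType dX) (PX : probability TX R)
    (X : {RV PX >-> field_space R d}) (k : lattice d)
    (f : field_space R d -> \bar R) :
  stationary X -> measurable_fun setT f -> (forall x, 0 <= f x) ->
  \int[PX]_w f (field_shift k (X w)) = \int[PX]_w f (X w).
Proof.
move=> sX mf f0.
have mX : measurable_fun setT X by exact: measurable_funPT.
have mkX : measurable_fun setT (field_shift k \o X).
  exact: measurableT_comp (@measurable_shift R d k) mX.
have f0T : {in [set: field_space R d], forall x, 0 <= f x} by move=> x _.
have := ge0_integral_pushforward mkX PX measurableT mf f0T.
rewrite preimage_setT => <-.
have := ge0_integral_pushforward mX PX measurableT mf f0T.
rewrite preimage_setT => <-.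
apply: eq_measure_integral => B mB _.
exact: sX.
Qed.

(** This is where stationarity enters. If F x <> 0 forces |x_0| > 1, then
    F (X / u) vanishes off the event |X_0| > u, so the numerator of the conditional
    expectation is the plain expectation of F (X / u), which a shift of X leaves
    unchanged provided that F composed with the shift has the same property. *)
Lemma cond_expectation_shift (R : realType) (d : nat) (dX : measure_display)
    (TX : measurableType dX) (PX : probability TX R)
    (X : {RV PX >-> field_space R d}) (k : lattice d)
    (F : field_space R d -> R) (u : R) :
  stationary X -> test_function F ->
  (forall x, F x != 0 -> 1 < `|x 0|)%R ->
  (forall x, F (field_shift k x) != 0 -> 1 < `|x 0|)%R ->
  (0 < u)%R ->
  cond_expectation PX [set w | (u < `|X w 0|)%R]
    (fun w => F (field_shift k (fun i => u^-1 * X w i)%R)) =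
  cond_expectation PX [set w | (u < `|X w 0|)%R]
    (fun w => F (fun i => u^-1 * X w i)%R).
Proof.
move=> sX [F01 mF _ _] F0 Fk0 u0.
have drop_cond (g : field_space R d -> R) : (forall x, g x != 0 -> 1 < `|x 0|)%R ->
    (\int[PX]_(w in [set w | (u < `|X w 0|)%R]) g (fun i => u^-1 * X w i) =
     \int[PX]_w g (fun i => u^-1 * X w i))%R.
  move=> g0; rewrite Rintegral_mkcond; apply: eq_Rintegral => w _.
  rewrite patchE; case: ifPn => // /negP; rewrite inE /= => uX.
  apply/esym/eqP/contraT => /g0; rewrite normrM normfV (gtr0_norm u0).
  by rewrite ltr_pdivlMl// mulr1 => /uX.
rewrite /cond_expectation (drop_cond F F0) (drop_cond _ Fk0).
congr (fine _ / _)%R.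
pose f (x : field_space R d) := (F (fun i => u^-1 * x i)%R)%:E.
have mf : measurable_fun setT f.
  apply/measurable_EFinP; apply: measurableT_comp mF _.
  exact: measurable_scale.
apply: (integral_shift_stationary k sX mf) => x.
by rewrite lee_fin; have /andP[] := F01 (fun i => u^-1 * x i)%R.
Qed.

(** Both sides are limits, as u tends to infinity, of conditional expectations
    that are equal for every u > 0. *)
Lemma integral_test_function_shift (R : realType) (d : nat) (dX dY : measure_display)
    (TX : measurableType dX) (TY : measurableType dY)
    (PX : probability TX R) (PY : probability TY R)
    (X : {RV PX >-> field_space R d}) (Y : {RV PY >-> field_space R d})
    (k : lattice d) (F : field_space R d -> R) :
  stationary X -> tail_process X Y ->
  test_function F -> test_function (F \o field_shift k) ->
  (forall x, F x != 0 -> 1 < `|x 0|)%R ->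
  (forall x, F (field_shift k x) != 0 -> 1 < `|x 0|)%R ->
  (\int[PY]_w F (field_shift k (Y w)) = \int[PY]_w F (Y w))%R.
Proof.
move=> sX XY tF tFk F0 Fk0.
have cvF := tail_process_cvg XY tF.
have cvFk := tail_process_cvg XY tFk.
apply: (cvg_unique (@norm_hausdorff _ R) cvFk).
apply: cvg_trans cvF; apply: near_eq_cvg; near=> u.
by apply/esym/cond_expectation_shift.
Unshelve. all: by end_near. Qed.

Lemma cvg_integral_approximation (R : realType) (d : nat) (dY : measure_display)
    (TY : measurableType dY) (PY : probability TY R)
    (g : TY -> field_space R d) (B : set (field_space R d))
    (F : nat -> field_space R d -> R) :
  measurable_fun setT g -> measurable B ->
  (forall n, test_function (F n)) ->
  (forall x, F ^~ x @ \oo --> (\1_B x : R)) ->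
  (\int[PY]_w F n (g w))%R @[n --> \oo] --> fine (PY (g @^-1` B)).
Proof.
move=> mg mB tF cF.
have mF n : measurable_fun setT (F n) by have [] := tF n.
have F01 n x : (0 <= F n x <= 1)%R by have [] := tF n.
have mgB : measurable (g @^-1` B) by rewrite -[X in measurable X]setTI; exact: mg.
have -> : PY (g @^-1` B) = \int[PY]_w (\1_B (g w))%:E.
  by rewrite -(setIT (g @^-1` B)) -integral_indic.
have mFg n : measurable_fun setT (fun w => (F n (g w))%:E).
  by apply/measurable_EFinP; exact: measurableT_comp.
have m1 : measurable_fun setT (fun w => (\1_B (g w))%:E : \bar R).
  apply/measurable_EFinP; apply: measurableT_comp mg.
  exact: measurable_indic.
have i1 : PY.-integrable setT (cst 1).
  exact: finite_measure_integrable_cst.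
have FB w : [set: TY] w ->
    (fun n => (F n (g w))%:E) @ \oo --> ((\1_B (g w))%:E : \bar R).
  by move=> _; apply: cvg_EFin; [exact: nearW|exact: cF].
have F1 w n : [set: TY] w -> (`|(F n (g w))%:E| <= cst (1 : \bar R) w).
  by move=> _; have /andP[? ?] := F01 n (g w); rewrite /= lee_fin ger0_norm.
have [i1B _ h] := dominated_convergence measurableT mFg m1 (aeW PY FB) i1 (aeW PY F1).
apply: fine_cvg.
by rewrite fineK//; exact: integrable_fin_num.
Qed.

(** Passing from test functions to indicators by dominated convergence gives the
    invariance on events; a possible atom of |Y_k| at 1 does no harm, because the
    functions increase to the indicator of the strict exceedance. *)
Lemma tail_process_shift_approximable (R : realType) (d : nat)
    (dX dY : measure_display)
    (TX : measurableType dX) (TY : measurableType dY)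
    (PX : probability TX R) (PY : probability TY R)
    (X : {RV PX >-> field_space R d}) (Y : {RV PY >-> field_space R d})
    (k : lattice d) (B : set (field_space R d)) :
  stationary X -> tail_process X Y -> measurable B -> approximable B ->
  (forall x, B x -> 1 < `|x 0|)%R ->
  (forall x, B (field_shift k x) -> 1 < `|x 0|)%R ->
  PY ((field_shift k \o Y) @^-1` B) = PY (Y @^-1` B).
Proof.
move=> sX XY mB [F [tF FB cF]] B0 Bk0.
have mY : measurable_fun setT Y by exact: measurable_funPT.
have mkY : measurable_fun setT (field_shift k \o Y).
  exact: measurableT_comp (@measurable_shift R d k) mY.
have tF0 n : test_function (F n).
  suff -> : F n = F n \o field_shift 0 by exact: tF.
  apply/funext => x; congr (F n _); apply/funext => i.
  by rewrite /field_shift addr0.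
have Fneq0 n x : F n x != 0%R -> B x.
  by move=> /eqP Fn0; apply: contrapT => /(FB n x).
have cY := cvg_integral_approximation (PY := PY) mY mB tF0 cF.
have ckY := cvg_integral_approximation (PY := PY) mkY mB tF0 cF.
have mYB : measurable (Y @^-1` B) by rewrite -[X in measurable X]setTI; exact: mY.
have mkYB : measurable ((field_shift k \o Y) @^-1` B).
  by rewrite -[X in measurable X]setTI; exact: mkY.
suff E : fine (PY ((field_shift k \o Y) @^-1` B)) = fine (PY (Y @^-1` B)).
  by rewrite -[LHS]fineK ?fin_num_measure// E fineK ?fin_num_measure.
apply: (cvg_unique (@norm_hausdorff _ R) ckY).
apply: cvg_trans cY; apply: near_eq_cvg; near=> n.
apply/esym/(integral_test_function_shift sX XY) => //.
- by move=> x /Fneq0/B0.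
- by move=> x /Fneq0/Bk0.
Unshelve. all: by end_near. Qed.

(** A pi-system of approximable sets that generates the product sigma-algebra;
    lists of constraints make closure under intersection a concatenation. *)
Definition orthant (R : realType) (d : nat) (s : seq (lattice d * R)) :
    set (field_space R d) :=
  [set x | all (fun p => (p.2 < x p.1)%R) s].

Lemma orthant_cat (R : realType) (d : nat) (s t : seq (lattice d * R)) :
  orthant (s ++ t) = orthant s `&` orthant t.
Proof. by apply/seteqP; split=> x /=; rewrite /orthant/= all_cat => /andP. Qed.

Lemma orthant_cons (R : realType) (d : nat) (p : lattice d * R)
    (s : seq (lattice d * R)) :
  orthant (p :: s) = [set x | (p.2 < x p.1)%R] `&` orthant s.
Proof. by apply/seteqP; split=> x /= /andP. Qed.

Lemma approximable_orthant (R : realType) (d : nat) (s : seq (lattice d * R)) :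
  approximable (orthant s).
Proof.
elim: s => [|[i a] s IHs].
  rewrite (_ : orthant [::] = setT); first exact: approximableT.
  by apply/seteqP; split.
rewrite orthant_cons; apply: approximableI IHs.
by apply: (@approximable_gt R d i id a) => x; exact: cvg_id.
Qed.

Lemma measurable_coord_gt (R : realType) (d : nat) (i : lattice d) (a : R) :
  measurable [set x : field_space R d | (a < x i)%R].
Proof.
rewrite -[X in measurable X]setTI.
have := @measurable_coord R d i measurableT `]a, +oo[%classic (measurable_itv _).
by congr measurable; apply/seteqP; split => x /=; rewrite in_itv/= andbT.
Qed.

Lemma measurable_exceed (R : realType) (d : nat) (k : lattice d) :
  measurable [set x : field_space R d | exceed x k].
Proof.
have mk : measurable_fun setT (fun x : field_space R d => `|x k|%R).
  by apply: measurableT_comp (@measurable_coord R d k); exact: normr_measurable.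
have := mk measurableT `]1%R, +oo[%classic (measurable_itv _).
rewrite setTI; congr measurable; apply/seteqP; split => x /=;
  by rewrite in_itv/= andbT.
Qed.

Lemma measurable_orthant (R : realType) (d : nat) (s : seq (lattice d * R)) :
  measurable (orthant s).
Proof.
elim: s => [|[i a] s IHs].
  rewrite (_ : orthant [::] = setT)//.
  by apply/seteqP; split.
rewrite orthant_cons; apply: measurableI IHs.
exact: measurable_coord_gt.
Qed.

Lemma orthant_generates (R : realType) (d : nat) :
  (@measurable _ (field_space R d)) `<=` <<s range (@orthant R d) >>.
Proof.
apply: smallest_sub; first exact: smallest_sigma_algebra.
move=> _ [i _ [B mB <-]]; rewrite setTI.
pose G := g_sigma_algebraType (range (@orthant R d)).
have : measurable_fun [set: G] (fun x : G => x i).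
  apply: (@measurability _ _ G R setT _ (@RGenOInfty.G R)).
    exact: RGenOInfty.measurableE.
  move=> _ [_ [a ->] <-]; rewrite setTI.
  apply: sub_sigma_algebra; exists [:: (i, a)] => //.
by move=> /(_ measurableT B mB); rewrite setTI.
Qed.

HB.instance Definition _ (R : realType) (d : nat) (k : lattice d) :=
  isMeasurableFun.Build _ _ _ _ (@field_shift R d k) (@measurable_shift R d k).

(** A tail process is not stationary, as it always exceeds 1 at the origin; it is
    stationary as seen from its exceedance points. On events where the origin and
    k are both exceedance points, moving the origin from one to the other preserves
    the law. *)
Definition exceedance_stationary (R : realType) (d : nat)
    (Q : probability (field_space R d) R) :=
  forall (k : lattice d) (B : set (field_space R d)), measurable B ->
    (forall x, B x -> exceed x 0%R /\ exceed x k) ->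
    Q (field_shift (- k)%R @^-1` B) = Q B.

(** Both sides, restricted to the event W that the origin and k are exceedance
    points, are finite measures in B. They agree on orthants, because an orthant
    intersected with W is approximable, hence everywhere. *)
Lemma tail_process_exceedance_stationary (R : realType) (d : nat)
    (dX dY : measure_display)
    (TX : measurableType dX) (TY : measurableType dY)
    (PX : probability TX R) (PY : probability TY R)
    (X : {RV PX >-> field_space R d}) (Y : {RV PY >-> field_space R d}) :
  stationary X -> tail_process X Y -> exceedance_stationary (distribution PY Y).
Proof.
move=> sX XY k B mB B0k.
pose W := [set x : field_space R d | exceed x 0%R] `&` [set x | exceed x k].
have mW : measurable W by apply: measurableI; exact: measurable_exceed.
have aW : approximable W.
  apply: approximableI; apply: approximable_gt => x; exact: norm_continuous.
have BW : B = B `&` W by apply/esym/setIidl => x /B0k.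
rewrite [in LHS]BW [in RHS]BW.
pose m1 := mrestr (distribution (distribution PY Y) (field_shift (- k)%R)) mW.
pose m2 := mrestr (distribution PY Y) mW.
apply: (@measure_unique _ R _ (range (@orthant R d)) (fun=> orthant [::]) _ _ _ _
  m1 m2 _ _ B mB).
- apply/seteqP; split; first exact: orthant_generates.
  apply: smallest_sub; first exact: sigma_algebra_measurable.
  by move=> _ [s _ <-]; exact: measurable_orthant.
- by move=> _ _ [s _ <-] [t _ <-]; exists (s ++ t) => //; rewrite orthant_cat.
- by move=> _; exists [::].
- by apply/seteqP; split => // x _; exists 0%N.
- move=> _ [s _ <-].
  apply: (tail_process_shift_approximable sX XY).
  + by apply: measurableI (mW); exact: measurable_orthant.
  + by apply: approximableI (aW); exact: approximable_orthant.
  + by move=> x [_ []].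
  + by move=> x [_ [_ /=]]; rewrite exceed_shift subrr; exact.
- move=> _; have mE : measurable (orthant [::] `&` W).
    by apply: measurableI (mW); exact: measurable_orthant.
  exact: le_lt_trans (probability_le1
    (distribution (distribution PY Y) (field_shift (- k)%R)) mE) (ltry 1%R).
Qed.

(** * Measurability through the set of exceedance points *)

Lemma measurable_fun_countable_cover (d1 d2 : measure_display)
    (T1 : measurableType d1) (T2 : measurableType d2) (U : countType)
    (D : set T1) (E : U -> set T1) (f : T1 -> T2) :
  D `<=` \bigcup_u E u -> (forall u, measurable (E u)) ->
  (forall u, measurable_fun (D `&` E u) f) -> measurable_fun D f.
Proof.
move=> DE mE mf mD B mB.
rewrite (_ : D `&` f @^-1` B = \bigcup_u (D `&` E u `&` f @^-1` B)).
  apply: countable_bigcupT_measurable => [|u]; first exact: countableP.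
  exact: mf (measurableI _ _ mD (mE u)) _ mB.
apply/seteqP; split=> [x [Dx fx]|x [u _ [[Dx _] fx]]//].
by have [u _ Eu] := DE _ Dx; exists u.
Qed.

(** Since the lattice is countable, it has countably many finite subsets; the sets
    of fields with a given finite set of exceedance points form a countable
    measurable partition of calE. Quantities that depend on x only through
    exceed x are constant on each piece, and sums over exceed x become sums over a
    fixed finite set there. *)
Definition exceed_pattern (R : realType) (d : nat) (F : {fset lattice d}) :
    set (field_space R d) :=
  [set x | exceed x = [set` F]].

Lemma measurable_exceed_pattern (R : realType) (d : nat) (F : {fset lattice d}) :
  measurable (@exceed_pattern R d F).
Proof.
rewrite -[X in measurable X]setCK; apply: measurableC.
rewrite (_ : ~` _ = \bigcup_k (if k \in F then ~` [set x | exceed x k]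
                               else [set x | exceed x k])); last first.
  apply/seteqP; split => [x xF|x [k _]].
    apply: contrapT => nx; apply: xF; apply/seteqP; split => k /= xk.
      apply: contrapT => kF; apply: nx; exists k => //.
      by rewrite ifN//; exact/negP.
    apply: contrapT => nk; apply: nx; exists k => //.
    by rewrite xk.
  by case: ifPn => kF /= xk xF; move: xk; rewrite xF//=; exact/negP.
apply: countable_bigcupT_measurable => [|k]; first exact: countableP.
by case: ifP => _; [apply: measurableC|]; exact: measurable_exceed.
Qed.

Lemma calE_pattern (R : realType) (d : nat) (x : field_space R d) :
  calE R d x -> exceed_pattern (fset_set (exceed x)) x.
Proof. by move=> [fx _]; rewrite /exceed_pattern/= fset_setK. Qed.

Lemma calE_nonempty (R : realType) (d : nat) (x : field_space R d) :
  calE R d x <-> finite_set (exceed x) /\ exceed x !=set0.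
Proof. by split=> -[fx x0]; split=> //; apply/(nexceed_gt0 fx). Qed.

Lemma measurable_calE_exceed (R : realType) (d : nat) (P : set (lattice d) -> Prop) :
  measurable [set x : field_space R d | calE R d x /\ P (exceed x)].
Proof.
rewrite (_ : [set x | _] = \bigcup_(F : {fset lattice d})
  (if `[< [set` F] !=set0 /\ P [set` F] >] then @exceed_pattern R d F else set0)).
  apply: countable_bigcupT_measurable => [|F]; first exact: countableP.
  by case: asboolP => _; [exact: measurable_exceed_pattern|exact: measurable0].
apply/seteqP; split => [x [Ex Px]|x [F _]].
  exists (fset_set (exceed x)) => //; case: asboolP => [_|].
    exact: calE_pattern.
  by case/calE_nonempty: Ex => fx x0; rewrite fset_setK//; case.
case: asboolP => // -[F0 PF] xF; rewrite /= xF; split => //.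
by apply/calE_nonempty; rewrite xF; split.
Qed.

Lemma measurable_calE (R : realType) (d : nat) : measurable (calE R d).
Proof.
have := @measurable_calE_exceed R d (fun=> True).
by congr measurable; apply/seteqP; split=> [x []|x].
Qed.

Lemma measurable_calE0 (R : realType) (d : nat) : measurable (calE0 R d).
Proof. exact: (@measurable_calE_exceed R d (fun S => S 0%R)). Qed.

Lemma measurable_fun_patternwise (R : realType) (d : nat) (dT : measure_display)
    (T : measurableType dT) (f : field_space R d -> T) :
  (forall F : {fset lattice d}, [set` F] !=set0 ->
     measurable_fun (exceed_pattern F) f) ->
  measurable_fun (calE R d) f.
Proof.
move=> mf.
apply: (@measurable_fun_countable_cover _ _ _ _ {fset lattice d} _
  (@exceed_pattern R d)).
- by move=> x Ex; exists (fset_set (exceed x)) => //; exact: calE_pattern.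
- exact: measurable_exceed_pattern.
- move=> F; have [F0|F0] := pselect ([set` F] !=set0).
    apply: measurable_funS (mf F F0); first exact: measurable_exceed_pattern.
    by move=> x [].
  rewrite (_ : _ `&` _ = set0); first exact: measurable_fun_set0.
  apply/seteqP; split => // x [/calE_nonempty[_ x0] xF].
  by apply: F0; rewrite -xF.
Qed.

Lemma measurable_nexceedV (R : realType) (d : nat) :
  measurable_fun (calE R d) (fun x => (nexceed x)%:R^-1 : R)%R.
Proof.
apply: measurable_fun_patternwise => F _.
apply: (eq_measurable_fun (cst (#|` F|%:R^-1 : R)%R)); last exact: measurable_cst.
by move=> x; rewrite inE => xF; rewrite /nexceed xF set_fsetK.
Qed.

Lemma measurable_div_nexceed (R : realType) (d : nat) (h : field_space R d -> R) :
  measurable_fun (calE R d) h ->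
  measurable_fun (calE0 R d) (fun x => h x / (nexceed x)%:R)%R.
Proof.
move=> mh.
apply: (measurable_funS _ _ (measurable_funM mh (@measurable_nexceedV R d))).
  exact: measurable_calE.
by move=> x [].
Qed.

Lemma measurable_sum_exceed (R : realType) (d : nat) (h : field_space R d -> R) :
  measurable_fun (calE0 R d) h ->
  measurable_fun (calE R d)
    (fun x => \sum_(k \in exceed x) h (field_shift k x))%R.
Proof.
move=> mh; apply: measurable_fun_patternwise => F F0.
apply: (eq_measurable_fun
  (fun x => \sum_(k <- F) if k \in F then h (field_shift k x) else 0)%R).
  move=> x; rewrite inE => xF.
  by rewrite xF fsbig_finite//= set_fsetK -big_mkcond -big_seq.
apply: measurable_sum => k; have [kF|_] := boolP (k \in F);
  last exact: measurable_cst.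
apply: (@measurable_comp _ _ _ _ _ _ (calE0 R d)) => //.
- exact: measurable_calE0.
- move=> _ [x xF <-]; apply: calE0_shift; last by rewrite xF.
  by apply/calE_nonempty; rewrite xF; split.
- exact: measurable_funTS (@measurable_shift R d k).
Qed.

(** * Anchoring and shift-invariant functions *)

Lemma calE_shift (R : realType) (d : nat) (k : lattice d) (x : field_space R d) :
  calE R d x -> calE R d (field_shift k x).
Proof.
move=> /calE_nonempty[fx [l xl]]; apply/calE_nonempty; split; last first.
  by exists (l - k)%R; rewrite exceed_shift subrK.
apply: sub_finite_set (finite_image (fun i => i - k)%R fx) => i xi.
by exists (i + k)%R; [exact: xi|rewrite addrK].
Qed.

Lemma anchor_ext_exceed (R : realType) (d : nat) (A : field_space R d -> lattice d)
    (x : field_space R d) :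
  anchoring A -> calE R d x -> exceed x (anchor_ext A x).
Proof.
move=> aA Ex; have [_ [l xl]] := (iffLR (calE_nonempty x) Ex).
rewrite (anchor_extE aA Ex xl) -exceed_shift.
by case: aA => _ eA _; apply: eA; exact: calE0_shift.
Qed.

Lemma anchor_shift_calE0 (R : realType) (d : nat)
    (A : field_space R d -> lattice d) (x : field_space R d) :
  anchoring A -> calE R d x -> calE0 R d (anchor_shift A x).
Proof. by move=> aA Ex; apply: calE0_shift => //; exact: anchor_ext_exceed. Qed.

Lemma anchor_extE0 (R : realType) (d : nat) (A : field_space R d -> lattice d)
    (x : field_space R d) :
  anchoring A -> calE0 R d x -> anchor_ext A x = A x.
Proof.
move=> aA [Ex x0]; rewrite (anchor_extE aA Ex x0) addr0.
by congr A; apply/funext => i; rewrite /field_shift addr0.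
Qed.

Lemma anchor_shift_invariant (R : realType) (d : nat)
    (A : field_space R d -> lattice d) :
  anchoring A -> shift_invariant (anchor_shift A).
Proof.
move=> aA x k Ex; have [_ [l xl]] := (iffLR (calE_nonempty x) Ex).
have kl : exceed (field_shift k x) (l - k)%R by rewrite exceed_shift subrK.
rewrite /anchor_shift (anchor_extE aA Ex xl) (anchor_extE aA (calE_shift k Ex) kl).
by rewrite !shift_shift -addrA !subrK.
Qed.

Lemma measurable_anchor_fiber (R : realType) (d : nat)
    (A : field_space R d -> lattice d) (k : lattice d) :
  anchoring A -> measurable (calE0 R d `&` [set x | A x = k]).
Proof. by move=> [mA _ _]; exact: (mA [set k]). Qed.

(** On the fields with a given exceedance pattern, the base point chosen in
    anchor_ext is a fixed l, and moving to the anchor is the shift by l followed by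
    the map y |-> field_shift (A y) y on calE0, which is a fixed shift on each
    of the countably many fibers of A. *)
Lemma measurable_anchor_shift (R : realType) (d : nat)
    (A : field_space R d -> lattice d) :
  anchoring A -> measurable_fun (calE R d) (anchor_shift A).
Proof.
move=> aA; apply: measurable_fun_patternwise => F F0.
set l := xget 0%R [set` F].
have Fl : [set` F] l by exact: xgetPex.
have EF x : exceed_pattern F x -> calE R d x.
  by move=> xF; apply/calE_nonempty; rewrite xF; split.
apply: (eq_measurable_fun ((fun y => field_shift (A y) y) \o field_shift l)).
  move=> x; rewrite inE => xF.
  rewrite /anchor_shift (anchor_extE aA (EF _ xF) (_ : exceed x l)) ?xF//.
  by rewrite -shift_shift.
apply: (@measurable_comp _ _ _ _ _ _ (calE0 R d)).
- exact: measurable_calE0.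
- move=> _ [x xF <-]; apply: calE0_shift; first exact: EF.
  by rewrite xF.
- apply: (@measurable_fun_countable_cover _ _ _ _ (lattice d) _
    (fun k => calE0 R d `&` [set x | A x = k])).
  + by move=> x E0x; exists (A x).
  + by move=> k; exact: measurable_anchor_fiber.
  + move=> k; apply: (eq_measurable_fun (field_shift k)).
      by move=> x; rewrite inE => -[_ [_ /= ->]].
    exact: measurable_funTS (@measurable_shift R d k).
- exact: measurable_funTS (@measurable_shift R d l).
Qed.

Lemma sum_exceed_shift_invariant (R : realType) (d : nat)
    (h : field_space R d -> R) :
  shift_invariant (fun x => \sum_(k \in exceed x) h (field_shift k x))%R.
Proof.
move=> x k _.
rewrite (reindex_fsbig (fun l => l - k)%R (exceed x) (exceed (field_shift k x))).
  by apply: eq_fsbigr => l _; rewrite shift_shift subrK.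
split => [l xl|l m _ _ /addIr//|l xl].
- by rewrite exceed_shift subrK.
- by exists (l + k)%R; [exact: xl|rewrite addrK].
Qed.

Lemma sum_exceed_cst (R : realType) (d : nat) (x : field_space R d) (c : R) :
  calE R d x -> (\sum_(k \in exceed x) c = c * (nexceed x)%:R)%R.
Proof.
move=> [fx _]; rewrite fsbig_finite//= big_const_seq count_predT.
by rewrite /nexceed iter_addr_0 mulr_natr.
Qed.

Lemma nexceed_shift_invariant (R : realType) (d : nat) :
  shift_invariant (fun x : field_space R d => (nexceed x)%:R : R)%R.
Proof.
move=> x k Ex; have := sum_exceed_shift_invariant (cst 1%R) k Ex.
by rewrite /= !sum_exceed_cst ?mul1r//; exact: calE_shift.
Qed.

(** Writing the finite random sum as a sum over the whole lattice separates the
    summation index from the field, so that the sum can be exchanged with an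
    integral. *)
Lemma sum_exceed_esum (R : realType) (d : nat) (h : field_space R d -> R)
    (x : field_space R d) :
  calE R d x -> (forall y, calE0 R d y -> 0 <= h y)%R ->
  (\sum_(k \in exceed x) h (field_shift k x))%R%:E =
  \esum_(k in [set: lattice d])
    ((fun y => (h (field_shift k y))%:E) \_ [set y | exceed y k]) x.
Proof.
move=> Ex h0; have [fx _] := Ex.
transitivity (\esum_(k in exceed x) (h (field_shift k x))%:E).
  rewrite esum_fset//; last first.
    by move=> k; rewrite inE lee_fin => xk; apply: h0; exact: calE0_shift.
  by rewrite !fsbig_finite//= sumEFin.
rewrite esum_mkcond; apply: eq_esum => k _; rewrite patchE.
by congr (if _ then _ else _); apply/idP/idP; rewrite !inE.
Qed.

Lemma measurable_anchor_shift_rv (R : realType) (d : nat) (dZ : measure_display)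
    (TZ : measurableType dZ) (PZ : probability TZ R)
    (Z : {RV PZ >-> field_space R d}) (A : field_space R d -> lattice d) :
  (forall w, calE R d (Z w)) -> anchoring A ->
  measurable_fun setT (anchor_shift A \o Z).
Proof.
move=> EZ aA; apply: (measurable_comp (@measurable_calE R d)).
- by move=> _ [w _ <-]; exact: EZ.
- exact: measurable_anchor_shift.
- exact: measurable_funPT.
Qed.

Lemma anchor_shift_anchored (R : realType) (d : nat)
    (A : field_space R d -> lattice d) (x : field_space R d) :
  anchoring A -> calE R d x -> A (anchor_shift A x) = 0%R.
Proof.
move=> aA Ex; have E0 := anchor_shift_calE0 aA Ex.
apply: (addIr (anchor_ext A x)); rewrite add0r.
by rewrite -(anchor_extE aA Ex (anchor_ext_exceed aA Ex)).
Qed.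

Lemma anchor_shift_id (R : realType) (d : nat)
    (A : field_space R d -> lattice d) (x : field_space R d) :
  anchoring A -> calE0 R d x -> A x = 0%R -> anchor_shift A x = x.
Proof.
move=> aA E0x Ax; rewrite /anchor_shift anchor_extE0// Ax.
by apply/funext => i; rewrite /field_shift addr0.
Qed.

Lemma nexceed_neq0 (R : realType) (d : nat) (x : field_space R d) :
  calE R d x -> (nexceed x)%:R != 0%R :> R.
Proof. by move=> [_]; rewrite pnatr_eq0 -lt0n. Qed.

(** Dividing by the number of exceedance points turns the sum over them into an
    average of equal terms. *)
Lemma sum_exceed_average (R : realType) (d : nat) (h : field_space R d -> R)
    (x : field_space R d) :
  shift_invariant h -> calE R d x ->
  (\sum_(k \in exceed x)
     (h (field_shift k x) / (nexceed (field_shift k x))%:R) = h x)%R.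
Proof.
move=> hs Ex.
transitivity (\sum_(k \in exceed x) (h x / (nexceed x)%:R))%R.
  by apply: eq_fsbigr => k _; rewrite hs// nexceed_shift_invariant.
by rewrite sum_exceed_cst// divfK// nexceed_neq0.
Qed.

(** * Mass transport to the anchor *)

(** A countable type is enumerated through its encoding in nat; the numbers that
    encode no element contribute zero. *)
Lemma esum_countable (R : realType) (I : countType) (a : I -> \bar R) :
  (forall i, 0 <= a i) ->
  \esum_(i in [set: I]) a i = \sum_(0 <= n <oo) oapp a 0 (pickle_inv n).
Proof.
move=> a0; rewrite nneseries_esumT; last by move=> n; case: pickle_inv => //=.
rewrite [RHS](_ : _ = \esum_(n in range (@choice.pickle I)) oapp a 0 (pickle_inv n)).
  rewrite (reindex_esum setT (range (@choice.pickle I)) (@choice.pickle I)).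
    by apply: eq_esum => i _; rewrite pickleK_inv.
  split => [i _|i j _ _|n [i _ <-]]; [by exists i| |by exists i].
  exact: (pcan_inj pickleK_inv).
rewrite [RHS]esum_mkcond; apply: eq_esum => n _.
case: ifPn => // /negP; rewrite inE => nn.
case E : pickle_inv => [i|//]; exfalso; apply: nn.
by exists i => //; have := @pickle_invK I n; rewrite E.
Qed.

Lemma integral_esum (R : realType) (dT : measure_display) (T : measurableType dT)
    (mu : measure T R) (D : set T) (I : countType) (f : I -> T -> \bar R) :
  measurable D -> (forall i, measurable_fun D (f i)) ->
  (forall i x, D x -> 0 <= f i x) ->
  \int[mu]_(x in D) (\esum_(i in [set: I]) f i x) =
  \esum_(i in [set: I]) \int[mu]_(x in D) f i x.
Proof.
move=> mD mf f0.
rewrite esum_countable; last by move=> i; apply: integral_ge0; exact: f0.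
pose g n x : \bar R := oapp (fun i => f i x) 0 (pickle_inv n).
transitivity (\int[mu]_(x in D) (\sum_(0 <= n <oo) g n x)).
  apply: eq_integral => x; rewrite inE => Dx.
  by rewrite esum_countable// => i; exact: f0.
rewrite integral_nneseries//.
- apply: eq_eseriesr => n _; rewrite /g; case: pickle_inv => //=.
  exact: integral0.
- by move=> n; rewrite /g; case: pickle_inv => /=.
- by move=> n x Dx; rewrite /g; case: pickle_inv => //= i; exact: f0.
Qed.

(** The shift by -k maps the fields anchored at -k onto the fields that are
    anchored at the origin and exceed 1 at k; on the image the origin and k are
    both exceedance points, so exceedance-stationarity applies. *)
Lemma integral_anchor_fiber (R : realType) (d : nat)
    (Q : probability (field_space R d) R) (A : field_space R d -> lattice d)
    (h : field_space R d -> R) (k : lattice d) :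
  exceedance_stationary Q -> anchoring A ->
  measurable_fun (calE0 R d) h -> (forall x, calE0 R d x -> 0 <= h x)%R ->
  \int[Q]_(x in calE0 R d `&` [set x | A x = (- k)%R]) (h x)%:E =
  \int[Q]_(x in (calE0 R d `&` [set x | A x = 0%R]) `&` [set x | exceed x k])
    (h (field_shift k x))%:E.
Proof.
move=> sQ aA mh h0.
have [_ eA shA] := aA.
set D := (X in _ = \int[Q]_(x in X) _).
have mD : measurable D.
  by apply: measurableI; [exact: measurable_anchor_fiber|exact: measurable_exceed].
have shiftK (x : field_space R d) : field_shift k (field_shift (- k)%R x) = x.
  rewrite shift_shift subrr; apply/funext => i.
  by rewrite /field_shift addr0.
have DE0 x : D x -> calE0 R d (field_shift k x).
  by move=> [[[Ex _] _] xk]; exact: calE0_shift.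
pose f x := (h (field_shift k x))%:E.
have mf : measurable_fun D f.
  apply/measurable_EFinP; apply: (@measurable_comp _ _ _ _ _ _ (calE0 R d)) => //.
  - exact: measurable_calE0.
  - by move=> _ [x Dx <-]; exact: DE0.
  - exact: measurable_funTS (@measurable_shift R d k).
have f0 : {in D, forall y, 0 <= f y}.
  by move=> y; rewrite inE => /DE0/h0; rewrite lee_fin.
have preD : field_shift (- k)%R @^-1` D = calE0 R d `&` [set x | A x = (- k)%R].
  apply/seteqP; split => x /=.
    move=> [[E0y Ay0] yk]; rewrite -(shiftK x); split; first exact: DE0.
    by rewrite /= -(addrK k (A _)) shA// Ay0 sub0r.
  move=> [E0x Ax]; have xk : exceed x (- k)%R by rewrite -Ax; exact: eA.
  split; last by rewrite /= exceed_shift subrr; exact: E0x.2.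
  split; first by apply: calE0_shift => //; exact: E0x.1.
  by rewrite /= -(addrK (- k)%R (A _)) shA// Ax subrr.
rewrite -preD.
transitivity (\int[Q]_(x in field_shift (- k)%R @^-1` D)
    (f \o field_shift (- k)%R) x).
  by apply: eq_integral => x _; rewrite /f /= shiftK.
rewrite -(ge0_integral_pushforward (@measurable_shift R d (- k)%R) Q mD mf f0).
apply: eq_measure_integral => B mB BD.
apply: sQ => // x /BD[[[_ x0] _] xk]; split; [exact: x0|exact: xk].
Qed.

(** Every field of calE0 sends its mass to its anchor. Splitting according to the
    position of the anchor and recentering each piece at the anchor, the field
    with anchor at the origin receives one contribution from each of its
    exceedance points. *)
Lemma mass_transport (R : realType) (d : nat)
    (Q : probability (field_space R d) R) (A : field_space R d -> lattice d)
    (h : field_space R d -> R) :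
  exceedance_stationary Q -> anchoring A ->
  measurable_fun (calE0 R d) h -> (forall x, calE0 R d x -> 0 <= h x)%R ->
  \int[Q]_(x in calE0 R d) (h x)%:E =
  \int[Q]_(x in calE0 R d `&` [set x | A x = 0%R])
    (\sum_(k \in exceed x) h (field_shift k x))%R%:E.
Proof.
move=> sQ aA mh h0.
have mA k := @measurable_anchor_fiber R d A k aA.
have mE0 := @measurable_calE0 R d.
(* Indexing the fibers by the opposite of the anchor makes k itself the
   exceedance point at which h is evaluated after recentering. *)
pose S k : set (field_space R d) := [set x | A x = (- k)%R].
transitivity (\int[Q]_(x in calE0 R d)
    \esum_(k in [set: lattice d]) ((fun x => (h x)%:E) \_ (calE0 R d `&` S k)) x).
  apply: eq_integral => x; rewrite inE => E0x.
  rewrite -[LHS](@esum_set1 R _ (- A x)%R (fun=> (h x)%:E)) ?lee_fin ?h0//.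
  rewrite esum_mkcond; apply: eq_esum => k _; rewrite patchE.
  congr (if _ then _ else _); apply/idP/idP; rewrite !inE.
    by move=> ->; split=> //; rewrite /S/= opprK.
  by move=> [_]; rewrite /S/= => ->; rewrite opprK.
rewrite integral_esum//; last 2 first.
- move=> k.
  apply/(@measurable_restrict _ _ _ _ (calE0 R d `&` S k) (calE0 R d)) => //.
    exact: mA.
  apply/measurable_EFinP; apply: measurable_funS mh => //.
- by move=> k x E0x; rewrite patchE; case: ifPn => // _; rewrite lee_fin; exact: h0.
transitivity (\esum_(k in [set: lattice d])
    \int[Q]_(x in calE0 R d `&` [set x | A x = 0%R])
      ((fun y => (h (field_shift k y))%:E) \_ [set y | exceed y k]) x).
  apply: eq_esum => k _.
  rewrite -integral_mkcondr setIA setIid integral_anchor_fiber//.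
  by rewrite integral_mkcondr.
rewrite -integral_esum//; last 2 first.
- move=> k.
  apply/(@measurable_restrict _ _ _ _ [set x | exceed x k]) => //.
    exact: measurable_exceed.
  apply/measurable_EFinP; apply: (@measurable_comp _ _ _ _ _ _ (calE0 R d)) => //.
  - by move=> _ [x [[[Ex _] _] xk] <-]; exact: calE0_shift.
  - exact: measurable_funTS (@measurable_shift R d k).
- move=> k x [[Ex _] _]; rewrite patchE; case: ifPn => //.
  by rewrite inE => xk; rewrite lee_fin h0//; exact: calE0_shift.
apply: eq_integral => x; rewrite inE => -[[Ex _] _].
by rewrite sum_exceed_esum.
Qed.

Lemma tail_mass_transport (R : realType) (d : nat) (dX dY : measure_display)
    (TX : measurableType dX) (TY : measurableType dY)
    (PX : probability TX R) (PY : probability TY R)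
    (X : {RV PX >-> field_space R d}) (Y : {RV PY >-> field_space R d})
    (A : field_space R d -> lattice d) (h : field_space R d -> R) :
  stationary X -> tail_process X Y -> anchoring A ->
  measurable_fun (calE0 R d) h -> (forall x, calE0 R d x -> 0 <= h x)%R ->
  \int[PY]_(w in Y @^-1` calE0 R d) (h (Y w))%:E =
  \int[PY]_(w in Y @^-1` (calE0 R d `&` [set x | A x = 0%R]))
    (\sum_(k \in exceed (Y w)) h (field_shift k (Y w)))%R%:E.
Proof.
move=> sX XY aA mh h0.
have sQ := tail_process_exceedance_stationary sX XY.
have mY : measurable_fun setT Y by exact: measurable_funPT.
have := mass_transport sQ aA mh h0.
rewrite (ge0_integral_pushforward mY PY (f := fun x => (h x)%:E)); first last.
- by move=> x; rewrite inE lee_fin; exact: h0.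
- exact/measurable_EFinP.
- exact: measurable_calE0.
move=> ->.
rewrite (ge0_integral_pushforward mY PY) //.
- exact: measurable_anchor_fiber.
- apply/measurable_EFinP; apply: measurable_funS (measurable_sum_exceed mh).
    exact: measurable_calE.
  by move=> x [[]].
- move=> x; rewrite inE => -[[Ex _] _]; rewrite lee_fin.
  by apply: fsumr_ge0 => k xk; apply: h0; exact: calE0_shift.
Qed.

Lemma tail_mass_transport_invariant (R : realType) (d : nat)
    (dX dY : measure_display)
    (TX : measurableType dX) (TY : measurableType dY)
    (PX : probability TX R) (PY : probability TY R)
    (X : {RV PX >-> field_space R d}) (Y : {RV PY >-> field_space R d})
    (A : field_space R d -> lattice d) (h : field_space R d -> R) :
  stationary X -> tail_process X Y -> anchoring A ->
  measurable_fun (calE R d) h -> (forall x, calE R d x -> 0 <= h x)%R ->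
  shift_invariant h ->
  \int[PY]_(w in Y @^-1` calE0 R d) (h (Y w) / (nexceed (Y w))%:R)%:E =
  \int[PY]_(w in Y @^-1` (calE0 R d `&` [set x | A x = 0%R])) (h (Y w))%:E.
Proof.
move=> sX XY aA mh h0 hs.
rewrite (tail_mass_transport (h := fun x => h x / (nexceed x)%:R)%R sX XY aA).
- apply: eq_integral => w; rewrite inE => -[[Ew _] _].
  by rewrite sum_exceed_average.
- exact: measurable_div_nexceed.
- by move=> x [Ex _]; rewrite divr_ge0 ?h0.
Qed.

(** * The lexicographically first exceedance point as an anchor *)

Section lexicographic_anchor.
Import Order.DefaultSeqLexiOrder.

Definition coords (d : nat) (k : lattice d) : seq int :=
  [seq k ord0 j | j <- enum 'I_d].

Lemma coords_inj (d : nat) : injective (@coords d).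
Proof.
move=> k l /eq_in_map kl; apply/rowP => j.
by apply: kl; rewrite mem_enum.
Qed.

(** Translation invariance of the order is what makes the least exceedance point
    move along with the field, which is the equivariance of an anchor. *)
Lemma le_coordsD (d : nat) (m k l : lattice d) :
  (coords (k + m)%R <= coords (l + m)%R)%O = (coords k <= coords l)%O.
Proof.
rewrite /coords; elim: (enum _) => //= j js IHjs.
by rewrite !Order.SeqLexiOrder.lexi_cons IHjs !mxE !lerD2r.
Qed.

Definition lex_least (d : nat) (S : set (lattice d)) : set (lattice d) :=
  [set k | S k /\ forall l, S l -> (coords k <= coords l)%O].

Lemma lex_least_exists (d : nat) (S : set (lattice d)) :
  finite_set S -> S !=set0 -> lex_least S !=set0.
Proof.
move=> /finite_seqP[s ->]; elim: s => [[]//|a s IHs _].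
have [s0|s0] := pselect ([set` s] !=set0); last first.
  exists a; split=> /=; first by rewrite mem_head.
  move=> l; rewrite inE => /predU1P[->//|ls].
  by exfalso; apply: s0; exists l.
have [b [sb b_le]] := IHs s0.
have [ab|ba] := leP (coords a) (coords b).
  exists a; split=> /=; first by rewrite mem_head.
  by move=> l; rewrite inE => /predU1P[->//|/b_le]; exact: le_trans.
exists b; split=> /=; first by rewrite inE sb orbT.
by move=> l; rewrite inE => /predU1P[->|/b_le//]; exact: ltW.
Qed.

Lemma lex_least_unique (d : nat) (S : set (lattice d)) (k l : lattice d) :
  lex_least S k -> lex_least S l -> k = l.
Proof.
move=> [Sk k_le] [Sl l_le]; apply: coords_inj; apply/le_anti.
by rewrite k_le// l_le.
Qed.

Lemma lex_least_shift (R : realType) (d : nat) (x : field_space R d)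
    (k l : lattice d) :
  lex_least (exceed (field_shift k x)) l -> lex_least (exceed x) (l + k)%R.
Proof.
move=> [xl l_le]; split; first exact: xl.
move=> m xm; rewrite -(subrK k m) le_coordsD; apply: l_le.
by rewrite exceed_shift subrK.
Qed.

End lexicographic_anchor.

Definition lex_anchor (R : realType) (d : nat) (x : field_space R d) : lattice d :=
  xget 0%R (lex_least (exceed x)).

Lemma anchoring_lex_anchor (R : realType) (d : nat) :
  anchoring (@lex_anchor R d).
Proof.
have leastP x : calE R d x -> lex_least (exceed x) (lex_anchor x).
  by move=> /calE_nonempty[fx x0]; apply: xgetPex; exact: lex_least_exists.
split.
- move=> B.
  have := @measurable_calE_exceed R d
    (fun S => S 0%R /\ B (xget 0%R (lex_least S))).
  by congr measurable; apply/seteqP; split => x; [move=> [? []]|move=> [[]]].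
- by move=> x [/leastP[]].
- move=> x k [Ex _] _; apply: lex_least_unique (leastP x Ex).
  exact: lex_least_shift (leastP _ (calE_shift k Ex)).
Qed.

(** * Characterizations of the representatives *)

(** Moving to the anchor puts all fields of calE into the set C of fields of
    calE0 that are anchored at the origin, and on C the law of the anchored Z is
    the law of Y divided by P (Y in C). *)
Lemma representative_integral (R : realType) (d : nat) (dY dZ : measure_display)
    (TY : measurableType dY) (TZ : measurableType dZ)
    (PY : probability TY R) (PZ : probability TZ R)
    (Y : {RV PY >-> field_space R d}) (Z : {RV PZ >-> field_space R d})
    (A : field_space R d -> lattice d) (H : field_space R d -> \bar R) :
  (forall w, calE R d (Z w)) -> anchoring A ->
  (forall B : set (field_space R d), measurable B ->
     PZ ((anchor_shift A \o Z) @^-1` B) = anchored_law Y A B) ->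
  measurable_fun (calE0 R d) H -> (forall x, calE0 R d x -> 0 <= H x) ->
  \int[PZ]_w H (anchor_shift A (Z w)) =
  (fine (PY (Y @^-1` (calE0 R d `&` [set x | A x = 0%R]))))^-1%:E *
  \int[PY]_(w in Y @^-1` (calE0 R d `&` [set x | A x = 0%R])) H (Y w).
Proof.
move=> EZ aA lawZ mH H0.
set C := calE0 R d `&` [set x | A x = 0%R].
have mC : measurable C by exact: measurable_anchor_fiber.
have mY : measurable_fun setT Y by exact: measurable_funPT.
have mW : measurable_fun setT (anchor_shift A \o Z).
  exact: measurable_anchor_shift_rv.
have mHC : measurable_fun C H.
  by apply: measurable_funS mH; [exact: measurable_calE0|move=> x []].
have HC0 x : C x -> 0 <= H x by move=> [/H0].
have WC : (anchor_shift A \o Z) @^-1` C = setT.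
  apply/seteqP; split => // w _; split.
    exact: anchor_shift_calE0.
  exact: anchor_shift_anchored.
pose p : {nonneg R} :=
  NngNum (ltac:(by rewrite invr_ge0 fine_ge0) :
    (0 <= (fine (PY (Y @^-1` C)))^-1)%R).
have := ge0_integral_pushforward mW PZ mC mHC (fun x xC => HC0 x (set_mem xC)).
rewrite WC => <-.
have := ge0_integral_pushforward mY PY mC mHC (fun x xC => HC0 x (set_mem xC)).
move=> /esym ->.
rewrite -[RHS](ge0_integral_mscale _ mC p mHC)//.
apply: eq_measure_integral => B mB BC.
transitivity (anchored_law Y A B); first exact: lawZ.
rewrite /anchored_law /cond_law -/C (setIidl BC) /mscale /= mulrC EFinM.
rewrite fineK// fin_num_measure//.
by rewrite -[X in measurable X]setTI; exact: mY.
Qed.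

Lemma integral1_calE0 (R : realType) (d : nat) (dY : measure_display)
    (TY : measurableType dY) (PY : probability TY R)
    (Y : {RV PY >-> field_space R d}) :
  PY (Y @^-1` calE0 R d) = 1 ->
  \int[PY]_(w in Y @^-1` calE0 R d) (1%R : R)%:E = 1.
Proof.
move=> hY; have mE : measurable (Y @^-1` calE0 R d).
  by apply: measurable_funPTI; exact: measurable_calE0.
by rewrite integral_cst// mul1e; exact: hY.
Qed.

(** Mass transport rewrites E [h Y] as an expectation over Y anchored at the origin
    of the shift-invariant function x |-> sum of h over the exceedance points, which
    takes the same value at Z and at the anchored Z. The constant function 1 then
    identifies the normalization. *)
Lemma representative_sum (R : realType) (d : nat)
    (dX dY dZ : measure_display)
    (TX : measurableType dX) (TY : measurableType dY) (TZ : measurableType dZ)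
    (PX : probability TX R) (PY : probability TY R) (PZ : probability TZ R)
    (X : {RV PX >-> field_space R d}) (Y : {RV PY >-> field_space R d})
    (Z : {RV PZ >-> field_space R d})
    (h : field_space R d -> R) :
  stationary X -> tail_process X Y -> PY (Y @^-1` calE0 R d) = 1 ->
  (forall w, calE R d (Z w)) -> representative Y Z ->
  measurable_fun (calE0 R d) h -> (forall x, calE0 R d x -> 0 <= h x)%R ->
  \int[PY]_(w in Y @^-1` calE0 R d) (h (Y w))%:E =
  ((fine 'E_PZ[fun w => (nexceed (Z w))%:R])^-1)%:E *
  'E_PZ[fun w => (\sum_(k \in exceed (Z w)) h (field_shift k (Z w)))%R].
Proof.
move=> hX hXY hY hZ [A [aA lawZ]] mh h0.
set p := fine (PY (Y @^-1` (calE0 R d `&` [set x | A x = 0%R]))).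
have key (g : field_space R d -> R) :
    measurable_fun (calE0 R d) g -> (forall x, calE0 R d x -> 0 <= g x)%R ->
    'E_PZ[fun w => (\sum_(k \in exceed (Z w)) g (field_shift k (Z w)))%R] =
    (p^-1)%:E * \int[PY]_(w in Y @^-1` calE0 R d) (g (Y w))%:E.
  move=> mg g0; rewrite (tail_mass_transport hX hXY aA mg g0) unlock.
  pose H (x : field_space R d) :=
    (\sum_(k \in exceed x) g (field_shift k x))%R.
  transitivity (\int[PZ]_w (H (anchor_shift A (Z w)))%:E).
    by apply: eq_integral => w _; rewrite /H sum_exceed_shift_invariant.
  apply: (representative_integral (H := EFin \o H) hZ aA lawZ).
  - apply/measurable_EFinP; apply: measurable_funS (measurable_sum_exceed mg).
      exact: measurable_calE.
    by move=> x [].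
  - move=> x [Ex _]; rewrite lee_fin.
    by apply: fsumr_ge0 => k xk; apply: g0; exact: calE0_shift.
have sum1 (w : TZ) :
    (\sum_(k \in exceed (Z w)) (1 : R) = (nexceed (Z w))%:R)%R.
  by rewrite sum_exceed_cst ?mul1r.
have EN : 'E_PZ[fun w => (nexceed (Z w))%:R] = (p^-1)%:E.
  have := key (cst 1%R) (measurable_cst _) (fun _ _ => ler01).
  rewrite integral1_calE0// mule1 => <-.
  by under eq_fun do rewrite -sum1.
(* If P (Y in C) were 0, the anchored law would be the zero measure, as x / 0 = 0,
   but it is the law of the anchored Z. *)
have p0 : p != 0%R.
  apply/eqP => p0; have := lawZ _ measurableT.
  rewrite preimage_setT probability_setT /anchored_law /cond_law -/p p0.
  by rewrite invr0 mulr0 => /eqP; rewrite eqe oner_eq0.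
by rewrite key// EN /= invrK muleA -EFinM divff// mul1e.
Qed.

(** The sum formula applied to h / N with h shift-invariant, N being the number of
    exceedance points; h = 1 shows that theta = 1 / E [N Z]. *)
Lemma shift_invariant_expectation (R : realType) (d : nat)
    (dY dZ : measure_display) (TY : measurableType dY) (TZ : measurableType dZ)
    (PY : probability TY R) (PZ : probability TZ R)
    (Y : {RV PY >-> field_space R d}) (Z : {RV PZ >-> field_space R d})
    (theta : R) (h : field_space R d -> R) :
  PY (Y @^-1` calE0 R d) = 1 ->
  theta%:E =
    \int[PY]_(w in Y @^-1` calE0 R d) ((nexceed (Y w))%:R^-1)%:E ->
  (forall w, calE R d (Z w)) ->
  (forall g : field_space R d -> R,
     measurable_fun (calE0 R d) g ->
     (forall x, calE0 R d x -> (0 <= g x)%R) ->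
     \int[PY]_(w in Y @^-1` calE0 R d) (g (Y w))%:E =
     ((fine 'E_PZ[fun w => (nexceed (Z w))%:R])^-1)%:E *
     'E_PZ[fun w => (\sum_(k \in exceed (Z w)) g (field_shift k (Z w)))%R]) ->
  measurable_fun (calE R d) h -> (forall x, calE R d x -> 0 <= h x)%R ->
  shift_invariant h ->
  'E_PZ[fun w => h (Z w)] =
  (theta^-1)%:E *
  \int[PY]_(w in Y @^-1` calE0 R d) (h (Y w) / (nexceed (Y w))%:R)%:E.
Proof.
move=> hY htheta hZ sumZ mh h0 hs.
set c := fine _ in sumZ.
have c0 : c != 0%R.
  apply/eqP => c0.
  have := sumZ (cst 1%R) (measurable_cst _) (fun _ _ => ler01).
  by rewrite integral1_calE0// c0 invr0 mul0e => /eqP; rewrite eqe oner_eq0.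
have avg (g : field_space R d -> R) :
    measurable_fun (calE R d) g -> (forall x, calE R d x -> 0 <= g x)%R ->
    shift_invariant g ->
    \int[PY]_(w in Y @^-1` calE0 R d) (g (Y w) / (nexceed (Y w))%:R)%:E =
    (c^-1)%:E * 'E_PZ[fun w => g (Z w)].
  move=> mg g0 gs.
  rewrite (sumZ (fun x => g x / (nexceed x)%:R)%R).
  - by under eq_fun do rewrite sum_exceed_average//.
  - exact: measurable_div_nexceed.
  - by move=> x [Ex _]; rewrite divr_ge0 ?g0.
have thetaE : theta = (c^-1)%R.
  apply: EFin_inj; rewrite htheta.
  have := avg (cst 1%R) (measurable_cst _) (fun _ _ => ler01)
    (fun _ _ _ => erefl).
  rewrite expectation_cst mule1 => <-.
  by apply: eq_integral => w _; rewrite /= mul1r.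
by rewrite avg// thetaE invrK muleA -EFinM divff// mul1e.
Qed.

(** The events of the anchored field are shift-invariant events of the original
    one, so the hypothesis determines the law of the anchored Z, and mass transport
    evaluates it on the Y side, where anchored fields are unchanged by anchoring. *)
Lemma representative_of_expectation (R : realType) (d : nat)
    (dX dY dZ : measure_display)
    (TX : measurableType dX) (TY : measurableType dY) (TZ : measurableType dZ)
    (PX : probability TX R) (PY : probability TY R) (PZ : probability TZ R)
    (X : {RV PX >-> field_space R d}) (Y : {RV PY >-> field_space R d})
    (Z : {RV PZ >-> field_space R d})
    (theta : R) :
  stationary X -> tail_process X Y ->
  theta%:E =
    \int[PY]_(w in Y @^-1` calE0 R d) ((nexceed (Y w))%:R^-1)%:E ->
  (forall w, calE R d (Z w)) ->
  (forall h : field_space R d -> R,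
     measurable_fun (calE R d) h ->
     (forall x, calE R d x -> (0 <= h x)%R) ->
     shift_invariant h ->
     'E_PZ[fun w => h (Z w)] =
     (theta^-1)%:E *
     \int[PY]_(w in Y @^-1` calE0 R d) (h (Y w) / (nexceed (Y w))%:R)%:E) ->
  representative Y Z.
Proof.
move=> hX hXY htheta hZ avgZ; pose A := @lex_anchor R d.
have aA : anchoring A := anchoring_lex_anchor R d.
exists A; split=> // B mB.
set C := calE0 R d `&` [set x | A x = 0%R].
have mYC : measurable (Y @^-1` C).
  by apply: measurable_funPTI; exact: measurable_anchor_fiber.
have mYB : measurable (Y @^-1` B) by exact: measurable_funPTI.
have thetaE : theta = fine (PY (Y @^-1` C)).
  rewrite -[LHS]/(fine theta%:E) htheta; congr fine.
  have := tail_mass_transport_invariant (h := cst 1%R) hX hXY aA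
    (measurable_cst _) (fun _ _ => ler01) (fun _ _ _ => erefl).
  rewrite /= integral_cst// mul1e => <-.
  by apply: eq_integral => w _; rewrite mul1r.
have mWB : measurable ((anchor_shift A \o Z) @^-1` B).
  by rewrite -[X in measurable X]setTI; exact: measurable_anchor_shift_rv.
pose h (x : field_space R d) := (\1_B (anchor_shift A x) : R)%R.
have mh : measurable_fun (calE R d) h.
  have mi : measurable_fun setT (\1_B : field_space R d -> R).
    exact: measurable_indic.
  exact: (measurableT_comp mi (measurable_anchor_shift aA)).
have hs : shift_invariant h.
  by move=> x k Ex; rewrite /h (anchor_shift_invariant aA).
have h0 x : calE R d x -> (0 <= h x)%R by rewrite /h indicE.
have := avgZ h mh h0 hs.
rewrite (tail_mass_transport_invariant hX hXY aA mh h0 hs) unlock -/C.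
rewrite (_ : \int[PZ]_w (h (Z w))%:E = PZ ((anchor_shift A \o Z) @^-1` B));
  last by rewrite -[X in PZ X]setIT -integral_indic.
move=> ->.
rewrite (_ : \int[PY]_(w in Y @^-1` C) (h (Y w))%:E = PY (Y @^-1` (B `&` C))).
  rewrite /anchored_law /cond_law thetaE -/C mulrC EFinM fineK//.
  by rewrite fin_num_measure// preimage_setI; exact: measurableI.
rewrite preimage_setI -integral_indic//.
apply: eq_integral => w; rewrite inE => -[E0w Aw].
by rewrite /h anchor_shift_id.
Qed.

Theorem proposition3p5 (R : realType) (d : nat) (hd : (0 < d)%N)
  (dX dY dZ : measure_display)
  (TX : measurableType dX) (TY : measurableType dY) (TZ : measurableType dZ)
  (PX : probability TX R) (PY : probability TY R) (PZ : probability TZ R)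
  (X : {RV PX >-> field_space R d}) (Y : {RV PY >-> field_space R d})
  (Z : {RV PZ >-> field_space R d})
  (hX : stationary X) (hXY : tail_process X Y)
  (hY : PY (Y @^-1` calE0 R d) = 1)
  (theta : R)
  (htheta : theta%:E =
    \int[PY]_(w in Y @^-1` calE0 R d) ((nexceed (Y w))%:R^-1)%:E)
  (hZ : forall w, calE R d (Z w))
  (hEZ : 'E_PZ[fun w => (nexceed (Z w))%:R] < +oo) :
  [<-> representative Y Z;
       forall h : field_space R d -> R,
         measurable_fun (calE0 R d) h ->
         (forall x, calE0 R d x -> (0 <= h x)%R) ->
         \int[PY]_(w in Y @^-1` calE0 R d) (h (Y w))%:E =
         ((fine 'E_PZ[fun w => (nexceed (Z w))%:R])^-1)%:E *
         'E_PZ[fun w => (\sum_(k \in exceed (Z w)) h (field_shift k (Z w)))%R];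
       forall h : field_space R d -> R,
         measurable_fun (calE R d) h ->
         (forall x, calE R d x -> (0 <= h x)%R) ->
         shift_invariant h ->
         'E_PZ[fun w => h (Z w)] =
         (theta^-1)%:E *
         \int[PY]_(w in Y @^-1` calE0 R d)
           (h (Y w) / (nexceed (Y w))%:R)%:E].
Proof.
tfae.
- move=> repZ h mh h0; exact: (representative_sum hX hXY hY hZ repZ mh h0).
- move=> sumZ h mh h0 hs.
  exact: (shift_invariant_expectation hY htheta hZ sumZ mh h0 hs).
- exact: (representative_of_expectation hX hXY htheta hZ).
Qed.
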